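(* Let $d\ge 2$ and $k\ge 1$ be integers, and let $S$ be a $d$-dimensional lattice simplex contained in the hypercube $[0,k]^d$. Then there exists at least one point of $\mathbb{Z}^d\cap[0,k]^d$ that can be inserted in $S$.
   Context: A lattice simplex in $\mathbb{R}^d$ is a simplex whose vertices all belong to $\mathbb{Z}^d$. A point $x\in\mathbb{R}^d\setminus P$ can be inserted in a $d$-dimensional polytope $P\subset\mathbb{R}^d$ with vertex set $\mathcal{V}$ if the vertex set of the convex hull of $P\cup\{x\}$ is exactly $\mathcal{V}\cup\{x\}$. *)

(* Defs.v *)
From HB Require Import structures.
From mathcomp Require Import all_boot all_order all_algebra.
From mathcomp Require Import all_classical all_reals all_analysis.

Set Implicit Arguments.
Unset Strict Implicit.
Unset Printing Implicit Defensive.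

Import Order.TTheory GRing.Theory Num.Theory.

Local Open Scope classical_set_scope.
Local Open Scope ring_scope.

Definition conv_hull (R : realType) (d : nat) (A : set 'rV[R]_d)
    : set 'rV[R]_d :=
  smallest (@convex_set R 'rV[R]_d) A.

(* The vertices of a polytope are its extreme points. *)
Definition vertices (R : realType) (d : nat) (P : set 'rV[R]_d)
    : set 'rV[R]_d :=
  [set x | P x /\
    forall (y z : 'rV[R]_d) (t : R), P y -> P z -> 0 < t < 1 ->
      x = t *: y + (1 - t) *: z -> y = x /\ z = x].

Definition affinely_independent (R : realType) (d n : nat)
    (v : 'I_n.+1 -> 'rV[R]_d) : Prop :=
  row_free (\matrix_(i < n) (v (lift ord0 i) - v ord0)).

(* n is the dimension of the simplex, d that of the ambient space. *)
Definition simplex (R : realType) (d n : nat) (S : set 'rV[R]_d) : Prop :=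
  exists2 v : 'I_n.+1 -> 'rV[R]_d,
    affinely_independent v & S = conv_hull (range v).

Definition integer_points (R : realType) (d : nat) : set 'rV[R]_d :=
  [set x | x \is a mxOver Num.int].

Definition lattice_simplex (R : realType) (d n : nat) (S : set 'rV[R]_d)
    : Prop :=
  simplex n S /\ vertices S `<=` @integer_points R d.

Definition hypercube (R : realType) (d k : nat) : set 'rV[R]_d :=
  [set x | forall i, 0 <= x ord0 i <= k%:R].

(* Only meant for P a polytope of dimension d. *)
Definition can_be_inserted (R : realType) (d : nat) (x : 'rV[R]_d)
    (P : set 'rV[R]_d) : Prop :=
  ~ P x /\ vertices (conv_hull (P `|` [set x])) = vertices P `|` [set x].

(* Main.v *)
Require Import Defs.
From HB Require Import structures.
From mathcomp Require Import all_boot all_order all_algebra.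
From mathcomp Require Import all_classical all_reals all_analysis.
From mathcomp Require Import lra.

Set Implicit Arguments.
Unset Strict Implicit.
Unset Printing Implicit Defensive.

Import Order.TTheory GRing.Theory Num.Theory.

Local Open Scope classical_set_scope.
Local Open Scope ring_scope.

(** Let [v] list the vertices of the simplex and write [lam x j] for the
    barycentric coordinates of [x].  A point with a negative coordinate lies
    outside the simplex, and two positive coordinates prevent it from swallowing
    a vertex: [v i] is a convex combination of [x] and the other vertices only
    if [lam x i] is the only positive coordinate of [x].  So a point with one
    negative and two positive coordinates can be inserted
    ([two_positive_can_be_inserted]).

    Suppose that no lattice point of the cube has coordinates of this kind
    ([no_two_positive]).  A corner of the cube then has exactly one positive
    coordinate, which gives it a colour; every colour occurs, because an affine
    function is maximal at a corner.  If [v p] is the highest vertex along the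
    axis [a], all corners of colour [p] are on the upper facet, hence [lam _ p]
    is increasing along [a] ([top_grows]), and symmetrically for the lowest
    vertex ([bot_shrinks]).

    Suppose moreover that the height of [v l] along [a] is neither 0 nor [k].
    The two lattice neighbours of [v l] along [a] would provide an insertable
    point if [l] was neither a highest nor a lowest vertex
    ([strictly_inside_extremal]).  With three vertices or more, this forces all
    the other vertices into a single facet of the cube, so that the simplex is a
    pyramid with apex [v l] ([strictly_inside_apex]).  The lattice hyperplane
    next to the base cuts it along a section which is too small to reach two
    opposite facets of the cube, although the assumption puts all the lattice
    points of that hyperplane in the simplex ([no_thin_slice]).

    Hence all vertices are corners, and every corner turns out to be a vertex
    ([corner_vertex]); this is impossible as soon as there are two axes, since the
    corners of a square are affinely dependent ([axes_equal]). *)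

(** * Convex hulls and their vertices *)

Section ConvexHulls.
Variables (R : realType) (d : nat).
Implicit Types (A : set 'rV[R]_d) (f : 'rV[R]_d -> R).

(** Unfolds the bounded scalars of the convex space structure into plain
    inequalities. *)
Lemma convex_setP A :
  @convex_set R 'rV[R]_d A <->
  (forall y z t, A y -> A z -> 0 < t < 1 -> A (t *: y + (1 - t) *: z)).
Proof.
split=> [cA y z t Ay Az /andP[t0 t1] | cA].
  by have := cA y z (Itv01 (ltW t0) (ltW t1)); rewrite !inE; apply.
apply/convex_setW => x y; rewrite !inE => Ax Ay t t0 t1.
by apply/mem_set/(cA x y t%:num) => //; rewrite t0.
Qed.

Definition affine f :=
  forall y z t, f (t *: y + (1 - t) *: z) = t * f y + (1 - t) * f z.

Lemma convex_conv_hull A : @convex_set R 'rV[R]_d (conv_hull A).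
Proof.
apply/convex_setP => y z t Ay Az t01 B [cB AB].
by move/convex_setP: (cB); apply=> //; [apply: Ay|apply: Az].
Qed.

Lemma sub_conv_hull A : A `<=` conv_hull A.
Proof. exact: sub_gen_smallest. Qed.

(** The hull with an extreme point removed is still convex; if the point was not
    in [A] this would be a smaller convex set containing [A]. *)
Lemma vertices_conv_hull_sub A : vertices (conv_hull A) `<=` A.
Proof.
move=> x [hx xext]; apply: contrapT => nAx.
suff /(_ x hx)[_ /=] : conv_hull A `<=` conv_hull A `\ x by [].
apply: smallest_sub => [|y Ay]; last first.
  by split=> [|/= yx]; [exact: sub_conv_hull | apply: nAx; rewrite -yx].
apply/convex_setP => y z t [hy yx] [hz zx] t01; split.
  by move/convex_setP: (@convex_conv_hull A); apply.
by move=> /= /esym e; have [] := xext _ _ _ hy hz t01 e.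
Qed.

(** An affine function that is minimal on [A] at [p] only is also minimal on the
    hull at [p] only, so that no segment of the hull passes through [p]. *)
Lemma exposed_vertices A f p : affine f -> A p ->
  (forall y, A y -> y <> p -> f p < f y) -> vertices (conv_hull A) p.
Proof.
move=> af Ap fp; split; first exact: sub_conv_hull.
have tie (a b t : R) : f p <= a -> f p <= b -> 0 < t < 1 ->
    f p = t * a + (1 - t) * b -> a = f p /\ b = f p.
  by move=> pa pb /andP[t0 t1] e; split; apply/eqP; rewrite eq_le; nra.
have sub : conv_hull A `<=` [set y | f p <= f y /\ (f y = f p -> y = p)].
  apply: smallest_sub => [|y Ay]; last first.
    have [->//|yp] := pselect (y = p); have lt := fp _ Ay yp.
    by split=> [|e]; [exact: ltW | rewrite e ltxx in lt].
  apply/convex_setP => y z t /= [py ey] [pz ez] t01; rewrite af; split.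
    by move/andP: t01 => [t0 t1]; nra.
  move=> /esym /(tie _ _ _ py pz t01)[/ey -> /ez ->].
  by rewrite -scalerDl addrC subrK scale1r.
move=> y z t /sub /= [py ey] /sub /= [pz ez] t01 e.
by have [] := tie _ _ t py pz t01; [rewrite -af -e | move=> /ey + /ez].
Qed.

End ConvexHulls.

(** * Barycentric coordinates and insertion *)

Section BarycentricCoordinates.
Variables (R : realType) (d : nat).
Variables (I : finType) (v : I -> 'rV[R]_d).
Variables (lam0 : I -> R) (slope : 'I_d -> I -> R).

(** The barycentric coordinates of a point with respect to [v] are affine in its
    coordinates: [slope b j] is the increase of the coordinate of index [j] along
    a unit step along the axis [b].  The constants are parameters, subject to the
    three identities below; [barycentric_coordinates] provides them. *)
Definition lam (x : 'rV[R]_d) (j : I) : R :=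
  lam0 j + \sum_b x ord0 b * slope b j.

Hypothesis sum_lam : forall x, \sum_j lam x j = 1.
Hypothesis lam_comb : forall x b, \sum_j lam x j * v j ord0 b = x ord0 b.
Hypothesis lam_vertex : forall i j, lam (v i) j = (j == i)%:R.

Lemma lam_affine j : affine (lam ^~ j).
Proof.
move=> y z t; rewrite /lam !mulrDr !mulr_sumr addrACA -mulrDl -big_split /=.
rewrite [t + _]addrC subrK mul1r; congr (_ + _); apply: eq_bigr => b _.
by rewrite !mxE mulrDl !mulrA.
Qed.

Lemma simplex_lam_ge0 y j : conv_hull (range v) y -> 0 <= lam y j.
Proof.
suff sub : conv_hull (range v) `<=` [set y | 0 <= lam y j] by move=> /sub.
apply: smallest_sub => [|_ [i _ <-] /=]; last by rewrite lam_vertex ler0n.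
apply/convex_setP => x z t /= x0 z0 /andP[t0 t1]; rewrite lam_affine.
by rewrite addr_ge0 // mulr_ge0 ?subr_ge0 // ltW.
Qed.

(** Nonnegative coordinates with sum 1 that include a 1 are those of a vertex. *)
Lemma simplex_lam_lt1 y i : conv_hull (range v) y -> y <> v i -> lam y i < 1.
Proof.
move=> Sy yi; rewrite ltNge; apply/negP => ge1; apply: yi.
have rest0 : \sum_(j | j != i) lam y j = 0.
  apply/eqP; rewrite eq_le sumr_ge0 ?andbT; last by move=> *; exact: simplex_lam_ge0.
  by have := sum_lam y; rewrite (bigD1 i) //=; lra.
have lam1 : lam y i = 1.
  by have := sum_lam y; rewrite (bigD1 i) //= rest0 addr0.
apply/rowP => b; rewrite -lam_comb (bigD1 i) //= lam1 mul1r big1 ?addr0 //.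
move=> j ji; rewrite (psumr_eq0P _ rest0) ?mul0r // => *.
exact: simplex_lam_ge0.
Qed.

(** [- lam _ i] exposes [v i]. *)
Lemma range_vertices : range v `<=` vertices (conv_hull (range v)).
Proof.
move=> _ [i _ <-]; apply: (@exposed_vertices _ _ _ (fun y => - lam y i)).
- by move=> y z t; rewrite lam_affine; lra.
- by exists i.
move=> _ [j _ <-] ji; rewrite !lam_vertex eqxx; case: eqP => [ij|_ /=]; last by lra.
by rewrite ij in ji.
Qed.

(** The new point is exposed by its negative coordinate.  A vertex [v i] stays
    exposed, by [- lam _ i] plus a multiple of a coordinate [lam _ r] which is
    positive at [x]; two positive coordinates ensure that some [r <> i] qualifies. *)
Lemma two_positive_can_be_inserted x n p q : p != q ->
  lam x n < 0 -> 0 < lam x p -> 0 < lam x q ->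
  can_be_inserted x (conv_hull (range v)).
Proof.
move=> pq xn xp xq.
have nSx : ~ conv_hull (range v) x.
  by move=> /(@simplex_lam_ge0 _ n); rewrite leNgt xn.
split=> //; apply/seteqP; split=> [y yext|y [/vertices_conv_hull_sub[i _ <-]|->]].
- have [Sy|->] := vertices_conv_hull_sub yext; last by right.
  left; split=> // a b t Sa Sb; apply: yext.2; apply: sub_conv_hull; by left.
- have [r ri xr] : exists2 r, r != i & 0 < lam x r.
    by have [ip|] := eqVneq p i; [exists q; rewrite // -ip eq_sym | exists p].
  (* the weight [w] lifts the value at [x] to at least 0, against -1 at [v i] *)
  pose w := `|lam x i| / lam x r.
  have w0 : 0 <= w by rewrite divr_ge0 // ltW.
  apply: (@exposed_vertices _ _ _ (fun y => w * lam y r - lam y i)).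
  + by move=> a b t; rewrite !lam_affine; lra.
  + by left; apply: sub_conv_hull; exists i.
  move=> z [Sz|->] zi; rewrite !lam_vertex eqxx (negPf ri) mulr0 sub0r.
    have := simplex_lam_lt1 Sz zi; have := mulr_ge0 w0 (simplex_lam_ge0 r Sz).
    by rewrite /=; lra.
  by rewrite /w divfK ?gt_eqF //; have := ler_norm (lam x i); rewrite /=; lra.
apply: (@exposed_vertices _ _ _ (lam ^~ n)); first exact: lam_affine.
  by right.
move=> z [Sz _|->//]; exact: lt_le_trans xn (simplex_lam_ge0 n Sz).
Qed.

(** * Lattice points of the cube when none has the coordinates for an insertion *)

Section NoInsertion.
Variables (k : nat) (hk : (1 <= k)%N).
Local Notation K := (k%:R : R).
Local Notation e a := (delta_mx ord0 a : 'rV[R]_d).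

Definition cube_point (x : 'rV[R]_d) := @integer_points R d x /\ @hypercube R d k x.

Hypothesis v_cube : forall i, cube_point (v i).

Hypothesis no_two_positive : forall x, cube_point x ->
  forall n p q, lam x n < 0 -> 0 < lam x p -> 0 < lam x q -> p = q.

Lemma K_gt0 : 0 < K. Proof. by rewrite ltr0n. Qed.

Lemma lam_shift x t a j : lam (x + t *: e a) j = lam x j + t * slope a j.
Proof.
rewrite /lam -addrA; congr (_ + _).
under eq_bigr => b _ do rewrite !mxE mulrDl.
rewrite big_split /=; congr (_ + _).
rewrite (bigD1 a) //= !eqxx mulr1 big1 ?addr0 // => b /negPf ba.
by rewrite ba mulr0 mul0r.
Qed.

Lemma shift_coord (x : 'rV[R]_d) t a b :
  (x + t *: e a) ord0 b = x ord0 b + (if b == a then t else 0).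
Proof. by rewrite !mxE eqxx; case: eqP => _; rewrite ?mulr1 ?mulr0. Qed.

Lemma cube_point_shift x t a : cube_point x -> t \is a Num.int ->
  0 <= x ord0 a + t <= K -> cube_point (x + t *: e a).
Proof.
move=> [xZ xk] tZ xt; split=> [|b]; last first.
  by rewrite shift_coord; case: eqP => [->|_] //; rewrite addr0.
apply/mxOverP => i b; rewrite [i]ord1 shift_coord.
have xb : x ord0 b \is a Num.int by move/mxOverP: xZ; apply.
by case: ifP => _; rewrite ?addr0 // rpredD.
Qed.

Definition corner (x : 'rV[R]_d) := forall b, x ord0 b = 0 \/ x ord0 b = K.

Lemma corner_cube_point x : corner x -> cube_point x.
Proof.
move=> cx; split=> [|b]; last by case: (cx b) => ->; rewrite lexx ler0n.
apply/mxOverP => i b; rewrite [i]ord1.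
by case: (cx b) => ->; rewrite ?rpred0 // rpred_nat.
Qed.

Lemma corner_shift x t a : corner x -> x ord0 a + t = 0 \/ x ord0 a + t = K ->
  corner (x + t *: e a).
Proof.
move=> cx xt b; rewrite shift_coord; case: eqP => [->//|_].
by rewrite addr0.
Qed.

(** Affine coordinate functions commute with barycentric combinations; taking the
    height relative to [c] makes the terms of all vertices of height [c] vanish. *)
Lemma lam_height x b (c : R) :
  \sum_j lam x j * (v j ord0 b - c) = x ord0 b - c.
Proof.
under eq_bigr do rewrite mulrBr.
by rewrite sumrB lam_comb -mulr_suml sum_lam mul1r.
Qed.

(** A convex combination that lies in a facet of the cube only involves vertices
    of this facet. *)
Lemma face_vertex x p b c : (forall j, 0 <= lam x j) -> 0 < lam x p ->
  c = 0 \/ c = K -> x ord0 b = c -> v p ord0 b = c.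
Proof.
move=> x0 xp cE xb; apply/eqP; rewrite -subr_eq0; apply/eqP.
have s0 : \sum_j lam x j * (v j ord0 b - c) = 0 by rewrite lam_height xb subrr.
have pz : lam x p * (v p ord0 b - c) = 0.
  have vb j := andP ((v_cube j).2 b).
  case: cE s0 => -> s0.
    apply: (psumr_eq0P _ s0) => // j _; rewrite subr0.
    by apply: mulr_ge0 => //; have [] := vb j.
  apply/eqP; rewrite -oppr_eq0 -mulrN; apply/eqP.
  move/eqP: s0; rewrite -oppr_eq0 -sumrN => /eqP s0.
  rewrite mulrN; apply: (psumr_eq0P _ s0) => // j _.
  by rewrite -mulrN opprB mulr_ge0 // subr_ge0; have [] := vb j.
by move/eqP: pz; rewrite mulf_eq0 (gt_eqF xp) => /eqP.
Qed.

Lemma v_inj : injective v.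
Proof.
move=> i j eq_ij; have := lam_vertex i i; rewrite eq_ij lam_vertex eqxx.
by case: eqP => // _ /eqP; rewrite eq_sym oner_eq0.
Qed.

(** This makes the index of the positive coordinate of a corner its colour.  Two
    positive coordinates exclude negative ones, so that the corner is in the
    simplex; as an extreme point of the cube it is then equal to both vertices. *)
Lemma colour_unique x p q : corner x -> 0 < lam x p -> 0 < lam x q -> p = q.
Proof.
move=> cx xp xq.
have [n xn|x0] := pickP (fun n => lam x n < 0).
  exact: no_two_positive (corner_cube_point cx) _ _ _ xn xp xq.
have {}x0 j : 0 <= lam x j by rewrite leNgt x0.
apply: v_inj; apply/rowP => b.
by rewrite (face_vertex x0 xp (cx b) erefl) (face_vertex x0 xq (cx b) erefl).
Qed.

Lemma colour_le0 x p q : corner x -> 0 < lam x p -> q != p -> lam x q <= 0.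
Proof.
move=> cx xp qp; rewrite leNgt; apply/negP => xq.
by rewrite (colour_unique cx xp xq) eqxx in qp.
Qed.

(** [lam _ p] is 1 at [v p] and reaches its maximum over the cube at the corner
    chosen by the signs of its slopes. *)
Lemma colour_exists p : exists2 x, corner x & 0 < lam x p.
Proof.
pose x : 'rV[R]_d := \row_b if 0 < slope b p then K else 0.
exists x; first by move=> b; rewrite mxE; case: ifP; [right|left].
have : 0 < lam (v p) p by rewrite lam_vertex eqxx.
move=> /lt_le_trans; apply; rewrite lerD2l; apply: ler_sum => b _; rewrite mxE.
have /andP[v0 vk] := (v_cube p).2 b.
case: ltP => D0; first by rewrite ler_pM2r.
by rewrite mul0r mulr_ge0_le0.
Qed.

Definition top a p := forall j, v j ord0 a <= v p ord0 a.
Definition bot a p := forall j, v p ord0 a <= v j ord0 a.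

(** The height of a corner of colour [p] is an affine combination where only the
    highest vertex has a positive weight. *)
Lemma colour_above x p a : corner x -> 0 < lam x p -> top a p ->
  v p ord0 a <= x ord0 a.
Proof.
move=> cx xp vp; rewrite -subr_ge0 -(lam_height x a (v p ord0 a)).
apply: sumr_ge0 => j _; have [->|jp] := eqVneq j p; first by rewrite subrr mulr0.
by rewrite mulr_le0 ?(colour_le0 cx xp) // subr_le0.
Qed.

Lemma colour_below x p a : corner x -> 0 < lam x p -> bot a p ->
  x ord0 a <= v p ord0 a.
Proof.
move=> cx xp vp; rewrite -subr_le0 -(lam_height x a (v p ord0 a)).
rewrite -oppr_ge0 -sumrN.
apply: sumr_ge0 => j _; have [->|jp] := eqVneq j p.
  by rewrite subrr mulr0 oppr0.
by rewrite -mulNr mulr_ge0 ?subr_ge0 // oppr_ge0 (colour_le0 cx xp).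
Qed.

(** The vertices affinely span the whole space, hence do not lie in a common facet
    of the cube. *)
Lemma top_gt0 a p : top a p -> 0 < v p ord0 a.
Proof.
move=> vp; rewrite ltNge; apply/negP => vp0.
have /andP[vp0' _] := (v_cube p).2 a.
have v0 j : v j ord0 a = 0.
  apply/eqP; rewrite eq_le (le_trans (vp j)) //=.
  by have /andP[] := (v_cube j).2 a.
have := lam_comb (const_mx K) a; rewrite big1 => [|j _]; last by rewrite v0 mulr0.
by rewrite mxE => /eqP; rewrite lt_eqF // K_gt0.
Qed.

Lemma bot_ltK a p : bot a p -> v p ord0 a < K.
Proof.
move=> vp; rewrite ltNge; apply/negP => vpK.
have v0 j : v j ord0 a = K.
  apply/eqP; rewrite eq_le (le_trans vpK) // andbT.
  by have /andP[] := (v_cube j).2 a.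
have := lam_height 0 a K; rewrite big1 => [|j _]; last by rewrite v0 subrr mulr0.
by rewrite mxE sub0r => /esym/eqP; rewrite oppr_eq0 gt_eqF // K_gt0.
Qed.

(** A corner of colour [p] is on the upper facet by [colour_above], so that the
    opposite corner along the axis, being on the lower facet, has another colour:
    [lam _ p] is positive at the former only. *)
Lemma top_grows a p : top a p -> 0 < slope a p.
Proof.
move=> vp; have [x cx xp] := colour_exists p.
have vp0 := top_gt0 vp.
have xa : x ord0 a = K.
  by case: (cx a) => // x0; have := colour_above cx xp vp; rewrite x0 leNgt vp0.
have cy : corner (x + - K *: e a) by apply: corner_shift => //; left; rewrite xa subrr.
have : lam (x + - K *: e a) p <= 0.
  rewrite leNgt; apply/negP => yp; have := colour_above cy yp vp.
  by rewrite shift_coord eqxx xa subrr leNgt vp0.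
rewrite lam_shift; have := K_gt0; nra.
Qed.

Lemma bot_shrinks a p : bot a p -> slope a p < 0.
Proof.
move=> vp; have [x cx xp] := colour_exists p.
have vpK := bot_ltK vp.
have xa : x ord0 a = 0.
  by case: (cx a) => // xK; have := colour_below cx xp vp; rewrite xK leNgt vpK.
have cy : corner (x + K *: e a) by apply: corner_shift => //; right; rewrite xa add0r.
have : lam (x + K *: e a) p <= 0.
  rewrite leNgt; apply/negP => yp; have := colour_below cy yp vp.
  by rewrite shift_coord eqxx xa add0r leNgt vpK.
rewrite lam_shift; have := K_gt0; nra.
Qed.

Definition strictly_inside a l := 0 < v l ord0 a < K.

Lemma int_gap (s t : R) : s \is a Num.int -> t \is a Num.int -> s < t -> s + 1 <= t.
Proof.
move=> /intrP[m ->] /intrP[n ->].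
by rewrite ltr_int -[1]/(1%:~R) -intrD ler_int lezD1.
Qed.

Lemma v_int j b : v j ord0 b \is a Num.int.
Proof. by have /mxOverP := (v_cube j).1; apply. Qed.

(** If [l], [p], [m] are distinct, both neighbours of [v l] along the axis have one
    negative and one positive coordinate among [p] and [m]; in at least one of
    them, the coordinate of index [l] is positive too. *)
Lemma strictly_inside_extremal a l p m :
  top a p -> bot a m -> strictly_inside a l ->
  l = p \/ l = m.
Proof.
move=> vp vm /andP[l0 lK].
have Dp := top_grows vp; have Dm := bot_shrinks vm.
have [->|lp] := eqVneq l p; first by left.
have [->|lm] := eqVneq l m; first by right.
have lamp : lam (v l) p = 0 by rewrite lam_vertex eq_sym (negPf lp).
have lamm : lam (v l) m = 0 by rewrite lam_vertex eq_sym (negPf lm).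
have laml : lam (v l) l = 1 by rewrite lam_vertex eqxx.
have up : cube_point (v l + 1 *: e a).
  apply: cube_point_shift; rewrite ?rpred1 // int_gap ?v_int ?rpred_nat //.
  by rewrite andbT; lra.
have down : cube_point (v l + (-1) *: e a).
  apply: cube_point_shift; rewrite ?rpredN ?rpred1 //.
  have := int_gap _ _ l0; rewrite rpred0 v_int => /(_ isT isT); lra.
exfalso; have [Dl|Dl] := leP 0 (slope a l).
  have := no_two_positive up (n := m) (p := l) (q := p).
  rewrite !lam_shift lamp lamm laml => H; move/eqP: lp; apply; apply: H; lra.
have := no_two_positive down (n := p) (p := l) (q := m).
rewrite !lam_shift lamp lamm laml => H; move/eqP: lm; apply; apply: H; lra.
Qed.

Lemma top_exists (i0 : I) a : exists p, top a p.
Proof.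
have [p _ hp] := arg_maxP (fun j => v j ord0 a) (erefl (xpredT i0)).
by exists p => j; apply: hp.
Qed.

Lemma bot_exists (i0 : I) a : exists p, bot a p.
Proof.
have [p _ hp] := arg_minP (fun j => v j ord0 a) (erefl (xpredT i0)).
by exists p => j; apply: hp.
Qed.

Lemma on_cube_facet a q : ~ strictly_inside a q -> v q ord0 a = 0 \/ v q ord0 a = K.
Proof.
have /andP[] := (v_cube q).2 a.
rewrite /strictly_inside !le_eqVlt => /orP[/eqP<-|->]; first by left.
by move=> /orP[/eqP->|->]; [right|].
Qed.

Hypothesis card_I : (3 <= #|I|)%N.

Lemma third_index (p m : I) : exists q, q != p /\ q != m.
Proof.
have [q /andP[qp qm]|none] := pickP (fun q => (q != p) && (q != m)).
  by exists q.
have /subset_leq_card : I \subset pred2 p m.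
  apply/fintype.subsetP => q _; rewrite !inE.
  by have /negbT := none q; rewrite negb_and !negbK.
by rewrite card2 => /(leq_trans card_I); case: (p != m).
Qed.

(** Say that [v l] is the highest vertex.  A third vertex, neither the highest nor
    the lowest, is on a facet of the cube by [strictly_inside_extremal]; this is
    the lower facet as the vertex is not above [v l], and then the lowest vertex
    is on the lower facet too. *)
Lemma strictly_inside_apex a l : strictly_inside a l ->
  (forall q, q != l -> v q ord0 a = 0) \/ (forall q, q != l -> v q ord0 a = K).
Proof.
move=> bl; have [p vp] := top_exists l a; have [m vm] := bot_exists l a.
have [q [qp qm]] := third_index p m.
have nbq r : r != p -> r != m -> v r ord0 a = 0 \/ v r ord0 a = K.
  move=> rp rm; apply: on_cube_facet => /(strictly_inside_extremal vp vm)[] /eqP.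
    by rewrite (negPf rp).
  by rewrite (negPf rm).
have [l0 lK] := andP bl; have m0 := vm l; have pl := vp l.
have ge0 r := andP ((v_cube r).2 a).
case: (strictly_inside_extremal vp vm bl) => ?; subst l.
- left.
  have r0 r : r != p -> r != m -> v r ord0 a = 0.
    by move=> rp rm; case: (nbq r rp rm) => // rK; have := vp r; rewrite rK; lra.
  move=> r rp; have [->|rm] := eqVneq r m; last exact: r0.
  by have := vm q; rewrite (r0 q) //; have [] := ge0 m; lra.
- right.
  have rK r : r != p -> r != m -> v r ord0 a = K.
    by move=> rp rm; case: (nbq r rp rm) => // r0; have := vm r; rewrite r0; lra.
  move=> r rm; have [->|rp] := eqVneq r p; last exact: rK.
  by have := vp q; rewrite (rK q) //; have [] := ge0 p; lra.
Qed.

(** With a negative coordinate, the only positive one would have to exceed 1. *)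
Lemma lam_ge0_of_le1 x l : cube_point x -> 0 < lam x l <= 1 -> forall j, 0 <= lam x j.
Proof.
move=> cx /andP[l0 l1] n; rewrite leNgt; apply/negP => n0.
have nl : n != l by apply: contraTneq n0 => ->; rewrite -leNgt ltW.
have := sum_lam x; rewrite (bigD1 l) //= (bigD1 n) //=.
suff : \sum_(i | (i != l) && (i != n)) lam x i <= 0 by lra.
apply: sumr_le0 => i /andP[il _]; rewrite leNgt; apply/negP => i0.
by rewrite (no_two_positive cx n0 l0 i0) eqxx in il.
Qed.

(** By [lam_ge0_of_le1], the lattice points of the cube in the hyperplane are in
    the simplex, and [v l] has a positive weight in each of them.  Applied to two
    of them on opposite facets along [b], [face_vertex] would put [v l] on both
    facets. *)
Lemma no_thin_slice (a b : 'I_d) l (s : R) :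
  a != b -> s \is a Num.int -> 0 <= s <= K ->
  (forall x : 'rV[R]_d, x ord0 a = s -> 0 < lam x l <= 1) -> False.
Proof.
move=> ab sZ s0K sl.
pose x t : 'rV[R]_d := (0 + s *: e a) + t *: e b.
have xa t : (x t) ord0 a = s.
  by rewrite !shift_coord (negPf ab) eqxx mxE add0r addr0.
have xb t : (x t) ord0 b = t.
  by rewrite !shift_coord eq_sym (negPf ab) eqxx mxE addr0 add0r.
have c0 : cube_point 0.
  by apply: corner_cube_point => c; left; rewrite mxE.
have cx t : t = 0 \/ t = K -> cube_point (x t).
  move=> tE; apply: cube_point_shift.
  - by apply: cube_point_shift => //; rewrite mxE add0r.
  - by case: tE => ->; rewrite ?rpred0 ?rpred_nat.
  - by rewrite shift_coord eq_sym (negPf ab) mxE !add0r;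
      case: tE => ->; rewrite lexx ler0n.
have vl t : t = 0 \/ t = K -> v l ord0 b = t.
  move=> tE; have l01 := sl _ (xa t); have [l0 _] := andP l01.
  exact: (face_vertex (lam_ge0_of_le1 (cx t tE) l01) l0 tE (xb t)).
have := K_gt0; rewrite -(vl K); last by right.
by rewrite (vl 0) ?ltxx //; left.
Qed.

(** The simplex is a pyramid with apex [v l] over a base in a facet of the cube.
    On the hyperplane at distance 1 from that facet, [lam _ l] is the inverse of
    the height of the pyramid, an integer that is at least 1. *)
Lemma no_strictly_inside (a b : 'I_d) l : a != b -> ~ strictly_inside a l.
Proof.
move=> ab bl; have [l0 lK] := andP bl.
have height s c (x : 'rV[R]_d) : (forall q, q != l -> v q ord0 a = c) -> x ord0 a = s ->
    lam x l * (v l ord0 a - c) = s - c.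
  move=> vc xs; rewrite -xs -(lam_height x a c) (bigD1 l) //= big1 ?addr0 //.
  by move=> q ql; rewrite vc // subrr mulr0.
have [vl Kl] : 1 <= v l ord0 a /\ v l ord0 a + 1 <= K.
  split; last by rewrite int_gap ?v_int ?rpred_nat.
  by rewrite -[1]add0r int_gap ?v_int ?rpred0.
have K1 := K_gt0.
case: (strictly_inside_apex bl) => vq.
- apply: (@no_thin_slice a b l 1) => //.
    by lra.
  by move=> x /(height _ _ _ vq); rewrite !subr0 => hl; apply/andP; split; nra.
- apply: (@no_thin_slice a b l (K - 1)) => //.
  + by apply: rpredB; [exact: rpred_nat | exact: rpred1].
  + by lra.
  by move=> x /(height _ _ _ vq) hl; apply/andP; split; nra.
Qed.

(** The vertex meant is the one given by the colour of the corner: by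
    [no_strictly_inside] each of its coordinates is 0 or [k], so that
    [colour_above] or [colour_below] applies. *)
Lemma corner_vertex (a b : 'I_d) x : a != b -> corner x -> exists p, x = v p.
Proof.
move=> ab cx.
have [p xp] : exists p, 0 < lam x p.
  apply: contrapT => nx; have := sum_lam x => /eqP.
  rewrite lt_eqF // (le_lt_trans _ ltr01) // sumr_le0 // => j _.
  by rewrite leNgt; apply/negP => xj; apply: nx; exists j.
exists p; apply/rowP => c.
have [c' cc'] : exists c', c != c'.
  by have [cornerA|] := eqVneq c a; [exists b; rewrite cornerA | exists a].
have vr q := (v_cube q).2 c.
case: (on_cube_facet (no_strictly_inside cc' (l := p))) => vpc; rewrite vpc.
  have := colour_below (a := c) cx xp; rewrite vpc.
  move=> /(_ _)H; apply/eqP; rewrite eq_le H => [|q]; last first.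
    by rewrite vpc; have /andP[] := vr q.
  by case: (cx c) => ->; rewrite ?lexx ?ler0n.
have := colour_above (a := c) cx xp; rewrite vpc.
move=> /(_ _)H; apply/eqP; rewrite eq_le H => [|q]; last first.
  by rewrite vpc; have /andP[] := vr q.
by case: (cx c) => ->; rewrite ?lexx ?ler0n.
Qed.

(** Four corners that form a square would be vertices; the coordinates of the
    fourth one, computed from the other three, give it two colours. *)
Lemma axes_equal (a b : 'I_d) : a = b.
Proof.
apply/eqP/negP => /negP ab; have K0 := K_gt0.
have K0' : K != 0 by rewrite gt_eqF.
have c0 : corner 0 by move=> c; left; rewrite mxE.
have cornerA : corner (0 + K *: e a).
  by apply: corner_shift => //; right; rewrite mxE add0r.
have cornerB : corner (0 + K *: e b).
  by apply: corner_shift => //; right; rewrite mxE add0r.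
have cab : corner (0 + K *: e a + K *: e b).
  apply: corner_shift => //; right.
  by rewrite shift_coord eq_sym (negPf ab) mxE !add0r.
have [h vh] := corner_vertex ab c0.
have [i vi] := corner_vertex ab cornerA.
have [j vj] := corner_vertex ab cornerB.
have neq_hi : h != i.
  apply/eqP => eq_hi; have := congr1 (fun x : 'rV[R]_d => x ord0 a) vi.
  by rewrite -eq_hi -vh shift_coord eqxx mxE add0r => /eqP; rewrite (negPf K0').
have neq_hj : h != j.
  apply/eqP => eq_hj; have := congr1 (fun x : 'rV[R]_d => x ord0 b) vj.
  by rewrite -eq_hj -vh shift_coord eqxx mxE add0r => /eqP; rewrite (negPf K0').
have neq_ij : i != j.
  apply/eqP => eq_ij; have := congr1 (fun x : 'rV[R]_d => x ord0 a) vi.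
  rewrite eq_ij -vj !shift_coord eqxx (negPf ab) mxE !add0r => /eqP.
  by rewrite (negPf K0').
have lab q : lam (0 + K *: e a + K *: e b) q =
    (q == i)%:R + (q == j)%:R - (q == h)%:R.
  rewrite lam_shift -!lam_vertex -vi -vj -vh !lam_shift; lra.
apply: (negP neq_ij); apply/eqP; apply: (colour_unique cab); rewrite lab eqxx.
  by rewrite (negPf neq_ij) [i == h]eq_sym (negPf neq_hi) /=; lra.
by rewrite [j == i]eq_sym (negPf neq_ij) [j == h]eq_sym (negPf neq_hj) /=; lra.
Qed.

End NoInsertion.

End BarycentricCoordinates.

(** * The simplex of the theorem *)

(** In homogeneous coordinates, the vertices are the rows of a square matrix, which
    is invertible by affine independence; the coordinates of [x] are then
    the row [(1, x)] times the inverse matrix. *)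
Lemma barycentric_coordinates (R : realType) (d : nat)
    (v : 'I_d.+1 -> 'rV[R]_d) : affinely_independent v ->
  exists (lam0 : 'I_d.+1 -> R) (slope : 'I_d -> 'I_d.+1 -> R),
  [/\ forall x, \sum_j lam lam0 slope x j = 1,
      forall x b, \sum_j lam lam0 slope x j * v j ord0 b = x ord0 b &
      forall i j, lam lam0 slope (v i) j = (j == i)%:R].
Proof.
move=> indep.
pose hom (x : 'rV[R]_d) : 'rV[R]_(1 + d) := row_mx (const_mx 1 : 'rV[R]_1) x.
pose M : 'M[R]_(1 + d) := \matrix_j hom (v j).
have mulM0 (u : 'rV_(1 + d)) : (u *m M) ord0 (lshift d ord0) = \sum_j u ord0 j.
  by rewrite mxE; apply: eq_bigr => j _; rewrite mxE row_mxEl mxE mulr1.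
have mulMb (u : 'rV_(1 + d)) b :
    (u *m M) ord0 (rshift 1 b) = \sum_j u ord0 j * v j ord0 b.
  by rewrite mxE; apply: eq_bigr => j _; rewrite mxE row_mxEr.
have unitM : M \in unitmx.
  rewrite -row_free_unit; apply: inj_row_free => u uM.
  have sum_u : \sum_j u ord0 j = 0 by rewrite -mulM0 uM mxE.
  pose w : 'rV[R]_d := \row_i u ord0 (lift ord0 i).
  have w0 : w = 0.
    apply: (row_free_inj indep); rewrite mul0mx; apply/rowP => b.
    have : \sum_j u ord0 j * (v j ord0 b - v ord0 ord0 b) = 0.
      under eq_bigr do rewrite mulrBr.
      by rewrite sumrB -mulMb uM -mulr_suml sum_u mul0r subr0 mxE.
    rewrite big_ord_recl subrr mulr0 add0r => s0.
    by rewrite !mxE -[RHS]s0; apply: eq_bigr => i _; rewrite !mxE.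
  have ulift i : u ord0 (lift ord0 i) = 0.
    by have /rowP/(_ i) := w0; rewrite !mxE.
  apply/rowP => j; rewrite mxE; case: (unliftP ord0 j) => [i ->|->] //.
  by move: sum_u; rewrite big_ord_recl big1 ?addr0.
pose B := invmx M.
exists (fun j => B (lshift d ord0) j), (fun b j => B (rshift 1 b) j).
have lamE x j : lam (fun j => B (lshift d ord0) j) (fun b j => B (rshift 1 b) j) x j
    = (hom x *m B) ord0 j.
  rewrite mxE big_split_ord /= big_ord1 row_mxEl mxE mul1r; congr (_ + _).
  by apply: eq_bigr => b _; rewrite row_mxEr.
split=> [x|x b|i j].
- under eq_bigr do rewrite lamE.
  by rewrite -mulM0 mulmxKV // row_mxEl mxE.
- under eq_bigr do rewrite lamE.
  by rewrite -mulMb mulmxKV // row_mxEr.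
rewrite lamE (_ : hom (v i) = row i M); last by rewrite rowK.
by rewrite -row_mul mulmxV // !mxE eq_sym.
Qed.

Theorem corollary3p5 (R : realType) (d k : nat) (hd : (2 <= d)%N)
    (hk : (1 <= k)%N) (S : set 'rV[R]_d) (hS : lattice_simplex d S)
    (hSk : S `<=` @hypercube R d k) :
  exists x : 'rV[R]_d,
    (@integer_points R d `&` @hypercube R d k) x /\ can_be_inserted x S.
Proof.
case: hS => -[v /barycentric_coordinates[lam0 [slope [sum1 comb vertex]]] SE] SZ.
apply: contrapT => none; rewrite {}SE in SZ hSk none.
have v_cube i : cube_point k (v i).
  have vi : vertices (conv_hull (range v)) (v i).
    by apply: (range_vertices vertex); exists i.
  by split; [exact: SZ | exact: hSk vi.1].
have no_two_positive x : cube_point k x -> forall n p q,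
    lam lam0 slope x n < 0 -> 0 < lam lam0 slope x p -> 0 < lam lam0 slope x q -> p = q.
  move=> cx n p q xn xp xq; apply/eqP/negP => /negP pq; apply: none; exists x.
  by split=> //; exact: (two_positive_can_be_inserted sum1 comb vertex pq xn xp xq).
have card_I : (3 <= #|'I_d.+1|)%N by rewrite card_ord.
have := axes_equal sum1 comb vertex hk v_cube no_two_positive card_I.
by move/(_ (Ordinal (ltnW hd)) (Ordinal hd))/(congr1 val).
Qed.
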